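(* Let $A\in\mathbb{R}^{n\times n}$ be symmetric positive-definite, $b\in\mathbb{R}^n$, $x=A^{-1}b$, and $k\ge1$. Let $\Omega\in\mathbb{R}^{\ell\times n}$ be an $\epsilon$-embedding of $\mathcal{K}_{k+1}+\mathrm{span}(x)$ with $\epsilon<\mathrm{cond}(A)^{-\frac12}$. Let $x_k\in\mathcal{K}_k$ be the estimate produced by a randomized orthogonal projection method, i.e. $\langle\Omega(b-Ax_k),\Omega y\rangle=0$ for all $y\in\mathcal{K}_k$, and let $\breve{x}_k\in\mathcal{K}_k$ be the estimate produced by the standard orthogonal projection method, i.e. $\langle b-A\breve{x}_k,y\rangle=0$ for all $y\in\mathcal{K}_k$. Then $$\|x-x_k\|_A\le\frac{1+\epsilon\,\mathrm{cond}(A)^{\frac12}}{1-\epsilon\,\mathrm{cond}(A)^{\frac12}}\,\|x-\breve{x}_k\|_A.$$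
   Context: The initial guess is $x_0=0$, and $\mathcal{K}_j=\mathrm{Span}\{b,Ab,\dots,A^{j-1}b\}$. $\langle\cdot,\cdot\rangle$ and $\|\cdot\|$ are Euclidean, $\|z\|_A^2=\langle Az,z\rangle$, and $\mathrm{cond}(A)$ is the spectral (2-norm) condition number of $A$. A matrix $\Omega\in\mathbb{R}^{\ell\times n}$ is an $\epsilon$-embedding of a subspace $\mathcal{V}\subset\mathbb{R}^n$ if $(1-\epsilon)\|z\|^2\le\|\Omega z\|^2\le(1+\epsilon)\|z\|^2$ for all $z\in\mathcal{V}$; equivalently, $|\langle\Omega z,\Omega y\rangle-\langle z,y\rangle|\le\epsilon\|z\|\|y\|$ for all $z,y\in\mathcal{V}$. *)

(* Defs.v *)
From mathcomp Require Import all_boot all_order all_algebra.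
From mathcomp Require Import classical_sets reals.

Set Implicit Arguments.
Unset Strict Implicit.
Unset Printing Implicit Defensive.

Import Order.TTheory GRing.Theory Num.Theory.
Local Open Scope ring_scope.
Local Open Scope classical_set_scope.

Definition dot (R : realType) (n : nat) (u v : 'cV[R]_n) : R :=
  (u^T *m v) 0 0.

Definition norm2 (R : realType) (n : nat) (z : 'cV[R]_n) : R :=
  Num.sqrt (dot z z).

Definition normA (R : realType) (n : nat) (A : 'M[R]_n) (z : 'cV[R]_n) : R :=
  Num.sqrt (dot (A *m z) z).

Definition spd (R : realType) (n : nat) (A : 'M[R]_n) : Prop :=
  A^T = A /\ forall z : 'cV[R]_n, z != 0 -> 0 < dot (A *m z) z.

(* The set is nonempty (take z = 0) and bounded (finite dimension), so [sup]
   is a genuine supremum here and not its default value 0. *)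
Definition opnorm2 (R : realType) (m n : nat) (M : 'M[R]_(m, n)) : R :=
  sup [set norm2 (M *m z) | z in [set z : 'cV[R]_n | norm2 z <= 1]].

(* Meaningful for invertible A only: [invmx A] is A itself otherwise. *)
Definition cond2 (R : realType) (n : nat) (A : 'M[R]_n) : R :=
  opnorm2 A * opnorm2 (invmx A).

Definition krylov (R : realType) (n : nat) (A : 'M[R]_n) (b : 'cV[R]_n)
    (j : nat) : {vspace 'cV[R]_n} :=
  <<mkseq (fun i => A ^+ i *m b) j>>%VS.

Definition embedding (R : realType) (l n : nat) (eps : R)
    (Omega : 'M[R]_(l, n)) (V : {vspace 'cV[R]_n}) : Prop :=
  forall z : 'cV[R]_n, z \in V ->
    (1 - eps) * norm2 z ^+ 2 <= norm2 (Omega *m z) ^+ 2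
    /\ norm2 (Omega *m z) ^+ 2 <= (1 + eps) * norm2 z ^+ 2.

Definition randomized_projection (R : realType) (l n : nat)
    (Omega : 'M[R]_(l, n)) (A : 'M[R]_n) (b : 'cV[R]_n) (k : nat)
    (xk : 'cV[R]_n) : Prop :=
  xk \in krylov A b k /\
  forall y : 'cV[R]_n, y \in krylov A b k ->
    dot (Omega *m (b - A *m xk)) (Omega *m y) = 0.

Definition orthogonal_projection (R : realType) (n : nat)
    (A : 'M[R]_n) (b : 'cV[R]_n) (k : nat) (xk : 'cV[R]_n) : Prop :=
  xk \in krylov A b k /\
  forall y : 'cV[R]_n, y \in krylov A b k -> dot (b - A *m xk) y = 0.

(* Main.v *)
Require Import Defs.
From mathcomp Require Import all_boot all_order all_algebra.
From mathcomp Require Import ring lra.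
From mathcomp Require Import classical_sets reals.

Set Implicit Arguments.
Unset Strict Implicit.
Unset Printing Implicit Defensive.

Import Order.TTheory GRing.Theory Num.Theory.
Local Open Scope ring_scope.

(** Write [e = x - xk], [e' = x - xk'], [d = xk' - xk] and
    [c = eps * sqrt (cond A)], so that [e = e' + d] with [d] in the Krylov
    space [K_k].

    The standard projection makes [A e'] orthogonal to [K_k], hence [e'] and
    [d] are [A]-orthogonal: [|e|_A^2 = |e'|_A^2 + |d|_A^2], and also
    [|d|_A^2 = <A e, d> = <r, d>] where [r = A e] is the residual of [xk].
    The randomized projection makes [Omega r] and [Omega d] orthogonal; both
    [r] and [d] lie in [K_{k+1}], where [Omega] perturbs inner products by at
    most [eps] times the product of the norms ([embedding_dot]), so
    [|d|_A^2 <= eps |r| |d|].  Euclidean norms are converted into energy norms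
    by [|A z|^2 <= opnorm2 A * |z|_A^2] ([spd_mulmx_le]), used for [A] at [e]
    and for the inverse of [A] at [A d]; the two constants multiply to
    [cond A], which gives [|d|_A <= c |e|_A].

    Altogether [(1 - c^2) |e|_A^2 <= |e'|_A^2], and for [0 <= c < 1] this is
    stronger than the claimed bound, as [(1 - c)^2 <= (1 + c)^2 (1 - c^2)].
    If [eps < 0] the embedding inequalities force every vector of [K_{k+1}],
    in particular [r] and [d], to vanish, and both sides are zero. *)

(** * The Euclidean inner product *)

Lemma dotDl (R : realType) n (u v w : 'cV[R]_n) :
  dot (u + v) w = dot u w + dot v w.
Proof. by rewrite /dot linearD /= mulmxDl mxE. Qed.

Lemma dotZl (R : realType) n a (u w : 'cV[R]_n) : dot (a *: u) w = a * dot u w.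
Proof. by rewrite /dot linearZ /= -scalemxAl mxE. Qed.

Lemma dotC (R : realType) n (u v : 'cV[R]_n) : dot u v = dot v u.
Proof.
by rewrite /dot -[in LHS](trmxK v) -trmx_mul [LHS]mxE.
Qed.

Lemma dotDr (R : realType) n (u v w : 'cV[R]_n) :
  dot u (v + w) = dot u v + dot u w.
Proof. by rewrite !(dotC u) dotDl. Qed.

Lemma dotZr (R : realType) n a (u w : 'cV[R]_n) : dot u (a *: w) = a * dot u w.
Proof. by rewrite !(dotC u) dotZl. Qed.

Lemma dot0l (R : realType) n (v : 'cV[R]_n) : dot 0 v = 0.
Proof. by rewrite -(scale0r 0) dotZl mul0r. Qed.

Lemma dot_sum (R : realType) n (u v : 'cV[R]_n) :
  dot u v = \sum_i u i 0 * v i 0.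
Proof. by rewrite /dot mxE; apply: eq_bigr => i _; rewrite mxE. Qed.

Lemma dot_ge0 (R : realType) n (z : 'cV[R]_n) : 0 <= dot z z.
Proof. by rewrite dot_sum sumr_ge0// => i _; rewrite -expr2 sqr_ge0. Qed.

Lemma dot_eq0 (R : realType) n (z : 'cV[R]_n) : dot z z = 0 -> z = 0.
Proof.
move/eqP; rewrite dot_sum psumr_eq0 => [/allP z0|i _]; last first.
  by rewrite -expr2 sqr_ge0.
apply/matrixP => i j; rewrite ord1 mxE; apply/eqP.
by have := z0 i (mem_index_enum i); rewrite /= mulf_eq0 orbb.
Qed.

Lemma dot_mulmxC (R : realType) n (A : 'M[R]_n) (u v : 'cV[R]_n) :
  A^T = A -> dot (A *m u) v = dot (A *m v) u.
Proof. by move=> sA; rewrite [LHS]dotC /dot trmx_mul sA mulmxA. Qed.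

Lemma norm2_ge0 (R : realType) n (z : 'cV[R]_n) : 0 <= norm2 z.
Proof. exact: sqrtr_ge0. Qed.

Lemma norm2_sqr (R : realType) n (z : 'cV[R]_n) : norm2 z ^+ 2 = dot z z.
Proof. by rewrite sqr_sqrtr// dot_ge0. Qed.

Lemma norm2_eq0 (R : realType) n (z : 'cV[R]_n) : norm2 z = 0 -> z = 0.
Proof. by move=> z0; apply: dot_eq0; rewrite -norm2_sqr z0 expr0n. Qed.

(** * Positive-definite matrices *)

Lemma spd1 (R : realType) n : spd (1%:M : 'M[R]_n).
Proof.
split=> [|z z0]; first exact: trmx1.
rewrite mul1mx lt_def dot_ge0 andbT.
by apply: contra z0 => /eqP/dot_eq0 ->.
Qed.

Lemma spd_ge0 (R : realType) n (A : 'M[R]_n) z : spd A -> 0 <= dot (A *m z) z.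
Proof.
case=> _ pA; have [->|/pA/ltW//] := eqVneq z 0.
by rewrite mulmx0 dot0l.
Qed.

Lemma normA_sqr (R : realType) n (A : 'M[R]_n) z :
  spd A -> normA A z ^+ 2 = dot (A *m z) z.
Proof. by move=> sA; rewrite sqr_sqrtr// spd_ge0. Qed.

Lemma spd_unitmx (R : realType) n (A : 'M[R]_n) : spd A -> A \in unitmx.
Proof.
move=> [sA pA]; rewrite -row_free_unit -kermx_eq0.
apply/eqP/row_matrixP => i; rewrite row0.
apply/eqP; apply: contraT => ker0.
have := pA (row i (kermx A))^T; rewrite trmx_eq0 => /(_ ker0).
by rewrite -[A in A *m _]sA -trmx_mul -row_mul mulmx_ker row0 trmx0 dot0l ltxx.
Qed.

Lemma spd_invmx (R : realType) n (A : 'M[R]_n) : spd A -> spd (invmx A).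
Proof.
move=> sA; have uA := spd_unitmx sA.
split=> [|z z0]; first by rewrite trmx_inv sA.1.
(* With [z = A w], the form of the inverse at [z] is that of [A] at [w]. *)
rewrite -{2}(mulKVmx uA z) dotC; apply: sA.2.
by apply: contra z0 => /eqP w0; rewrite -(mulKVmx uA z) w0 mulmx0.
Qed.

(** The discriminant argument: [p] and [q] make [q u - p v] the
    [A]-orthogonal component of [u] relative to [v], rescaled by [q]. *)
Lemma spd_cauchy_schwarz (R : realType) n (A : 'M[R]_n) u v : spd A ->
  dot (A *m u) v ^+ 2 <= dot (A *m u) u * dot (A *m v) v.
Proof.
move=> sA; have [->|v0] := eqVneq v 0.
  by rewrite dotC mulmx0 !dot0l mulr0 expr0n.
have q0 := sA.2 _ v0.
set p := dot (A *m u) v; set q := dot (A *m v) v in q0 *.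
have := spd_ge0 (q *: u + (- p) *: v) sA.
rewrite mulmxDr -!scalemxAr !dotDl !dotDr !dotZl !dotZr.
rewrite [dot (A *m v) u](dot_mulmxC v u sA.1) -/p -/q => h.
have: 0 <= q * (dot (A *m u) u * q - p ^+ 2).
  by move: h; congr (0 <= _); ring.
by rewrite pmulr_rge0// subr_ge0.
Qed.

Lemma dot_cauchy_schwarz (R : realType) n (u v : 'cV[R]_n) :
  dot u v ^+ 2 <= dot u u * dot v v.
Proof. by have := spd_cauchy_schwarz u v (spd1 R n); rewrite !mul1mx. Qed.

Lemma dot_le_norm2 (R : realType) n (u v : 'cV[R]_n) :
  dot u v <= norm2 u * norm2 v.
Proof.
rewrite (le_trans (ler_norm _))// -ler_sqr ?nnegrE ?mulr_ge0 ?norm2_ge0//.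
by rewrite real_normK ?num_real// exprMn !norm2_sqr dot_cauchy_schwarz.
Qed.

(** * The operator norm *)

(** The Frobenius norm of [M] dominates [M] on the unit ball: this is what
    makes the supremum defining [opnorm2 M] an upper bound. *)
Lemma opnorm2_has_ubound (R : realType) m n (M : 'M[R]_(m, n)) :
  has_ubound [set norm2 (M *m z) | z in [set z : 'cV[R]_n | norm2 z <= 1]]%classic.
Proof.
set F := \sum_i dot (row i M)^T (row i M)^T.
have F0 : 0 <= F by apply: sumr_ge0 => i _; apply: dot_ge0.
exists (Num.sqrt F) => _ [z /= z1 <-]; rewrite ler_wsqrtr// dot_sum ler_sum// => i _.
have -> : (M *m z) i 0 = dot (row i M)^T z.
  by rewrite /dot trmxK -row_mul [RHS]mxE.
rewrite -expr2 (le_trans (dot_cauchy_schwarz _ _))//.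
by rewrite ler_piMr ?dot_ge0// -norm2_sqr expr_le1// norm2_ge0.
Qed.

Lemma norm2Z (R : realType) n a (z : 'cV[R]_n) :
  0 <= a -> norm2 (a *: z) = a * norm2 z.
Proof.
by move=> a0; rewrite /norm2 dotZl dotZr mulrA -expr2 sqrtrM ?sqr_ge0// sqrtr_sqr ger0_norm.
Qed.

Lemma norm2_mulmx_le (R : realType) m n (M : 'M[R]_(m, n)) z :
  norm2 (M *m z) <= opnorm2 M * norm2 z.
Proof.
have [z0|z0] := eqVneq (norm2 z) 0.
  by rewrite z0 (norm2_eq0 z0) mulmx0 /norm2 dot0l sqrtr0 mulr0.
have zp : 0 < norm2 z by rewrite lt_def z0 norm2_ge0.
rewrite -ler_pdivrMr// mulrC -norm2Z ?invr_ge0 ?norm2_ge0// scalemxAr.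
apply: sup_ubound; first exact: opnorm2_has_ubound.
exists ((norm2 z)^-1 *: z) => //=.
by rewrite norm2Z ?invr_ge0 ?norm2_ge0// mulVf.
Qed.

Lemma opnorm2_ge0 (R : realType) m n (M : 'M[R]_(m, n)) : 0 <= opnorm2 M.
Proof.
apply: le_trans (norm2_ge0 (M *m 0)) _; apply: sup_ubound.
  exact: opnorm2_has_ubound.
by exists 0 => //=; rewrite /norm2 dot0l sqrtr0 ler01.
Qed.

(** Cauchy-Schwarz for the form of [A] at [z] and [A z] gives
    [|A z|^4 <= |z|_A^2 |A z|_A^2], and
    [|A z|_A^2 = <A (A z), A z> <= opnorm2 A * |A z|^2]; this avoids any
    spectral decomposition or square root of [A]. *)
Lemma spd_mulmx_le (R : realType) n (A : 'M[R]_n) z : spd A ->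
  dot (A *m z) (A *m z) <= opnorm2 A * dot (A *m z) z.
Proof.
move=> sA; set y := A *m z.
have := dot_ge0 y; rewrite le_eqVlt => /orP[/eqP <-|y0].
  by rewrite mulr_ge0 ?opnorm2_ge0 ?spd_ge0.
rewrite -(ler_pM2r y0) -expr2.
apply: le_trans (spd_cauchy_schwarz z y sA) _.
rewrite [leRHS]mulrAC [leRHS]mulrC ler_wpM2l ?spd_ge0//.
apply: le_trans (dot_le_norm2 _ _) _.
by rewrite -norm2_sqr expr2 mulrA ler_wpM2r ?norm2_ge0 ?norm2_mulmx_le.
Qed.

(** * Krylov spaces *)

Lemma krylov_sub (R : realType) n (A : 'M[R]_n) b j j' :
  (j <= j')%N -> (krylov A b j <= krylov A b j')%VS.
Proof.
move=> jj'; apply: sub_span => v /mapP[i]; rewrite mem_iota => /= ij ->.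
by apply: map_f; rewrite mem_iota /= (leq_trans ij).
Qed.

Lemma krylov_generator (R : realType) n (A : 'M[R]_n) b j :
  b \in krylov A b j.+1.
Proof.
apply: memv_span; apply/mapP; exists 0%N; first by rewrite mem_iota.
by rewrite expr0 mul1mx.
Qed.

Lemma krylov_mulmx (R : realType) n (A : 'M[R]_n) b j v :
  v \in krylov A b j -> A *m v \in krylov A b j.+1.
Proof.
move=> vK; have -> : A *m v = linfun (mulmx A) v by rewrite lfunE.
apply: (subvP _ _ (memv_img _ vK)); rewrite limg_span.
apply/span_subvP => w /mapP[u /mapP[i + ->] ->]; rewrite mem_iota /= => ij.
apply: memv_span; apply/mapP; exists i.+1; first by rewrite mem_iota.
by rewrite lfunE /= mulmxA exprS.
Qed.

(** * Embeddings *)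

Lemma embedding_sub (R : realType) l n eps (Omega : 'M[R]_(l, n)) U V :
  (U <= V)%VS -> embedding eps Omega V -> embedding eps Omega U.
Proof. by move=> /subvP UV emb z /UV; apply: emb. Qed.

Lemma embedding_lt0 (R : realType) l n eps (Omega : 'M[R]_(l, n)) V z :
  embedding eps Omega V -> eps < 0 -> z \in V -> z = 0.
Proof.
move=> emb eps0 /emb[h1 h2]; apply: dot_eq0; rewrite -norm2_sqr.
apply/eqP; rewrite eq_le sqr_ge0 andbT.
by have := le_trans h1 h2; nra.
Qed.

(** The parallelogram and polarization identities, applied to
    [|y| z + |z| y] and [|y| z - |z| y]: scaling both vectors to the common
    length [|z| |y|] turns the error [eps (|u|^2 + |v|^2) / 2] into
    [eps |u| |v|]. *)
Lemma embedding_dot (R : realType) l n eps (Omega : 'M[R]_(l, n)) V z y :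
  embedding eps Omega V -> z \in V -> y \in V ->
  dot z y - dot (Omega *m z) (Omega *m y) <= eps * (norm2 z * norm2 y).
Proof.
move=> emb zV yV.
have [z0|z0] := eqVneq (norm2 z) 0.
  by rewrite z0 (norm2_eq0 z0) mulmx0 !dot0l subrr mul0r mulr0.
have [y0|y0] := eqVneq (norm2 y) 0.
  rewrite y0 (norm2_eq0 y0) mulmx0 dotC dot0l dotC dot0l.
  by rewrite subrr mulr0 mulr0.
have zp : 0 < norm2 z by rewrite lt_def z0 norm2_ge0.
have yp : 0 < norm2 y by rewrite lt_def y0 norm2_ge0.
have comb a : norm2 y *: z + a *: y \in V by rewrite rpredD ?rpredZ.
have [+ _] := emb _ (comb (norm2 z)); have [_ +] := emb _ (comb (- norm2 z)).
rewrite !norm2_sqr !mulmxDr -!scalemxAr !dotDl !dotDr !dotZl !dotZr.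
rewrite [dot y z]dotC [dot (Omega *m y) (Omega *m z)]dotC -!norm2_sqr.
set a := norm2 z in zp *; set c := norm2 y in yp *.
set s := dot z y; set t := dot (Omega *m z) (Omega *m y).
move=> h1 h2.
rewrite -(ler_pM2l (mulr_gt0 zp yp)).
by lra.
Qed.

(** * Quasi-optimality *)

(** The Euclidean norms of the residual [A e] and of [d] cost one factor
    [opnorm2 A] and one factor [opnorm2 (invmx A)], hence [cond2 A]. *)
Lemma norm2_residual_mul_le (R : realType) n (A : 'M[R]_n) e d : spd A ->
  norm2 (A *m e) * norm2 d <= Num.sqrt (cond2 A) * (normA A e * normA A d).
Proof.
move=> sA; have uA := spd_unitmx sA.
have hd := spd_mulmx_le (A *m d) (spd_invmx sA).
rewrite mulKmx// (dotC d (A *m d)) in hd.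
rewrite -sqrtrM ?dot_ge0// /normA -!sqrtrM ?spd_ge0//; last first.
  by rewrite mulr_ge0 ?opnorm2_ge0.
by rewrite ler_wsqrtr// mulrACA ler_pM ?dot_ge0 ?spd_mulmx_le.
Qed.

Lemma quasi_optimal_bound (R : realType) (c p q s : R) :
  0 <= c -> c < 1 -> 0 <= p -> 0 <= q -> 0 <= s ->
  p ^+ 2 = q ^+ 2 + s ^+ 2 -> s <= c * p ->
  p <= (1 + c) / (1 - c) * q.
Proof.
move=> c0 c1 p0 q0 s0 pyth sp.
have d0 : 0 < 1 - c by rewrite subr_gt0.
rewrite mulrAC ler_pdivlMr// mulrC -ler_sqr ?nnegrE; last 2 first.
- by rewrite mulr_ge0// ltW.
- by rewrite mulr_ge0// addr_ge0.
have s2 : s ^+ 2 <= (c * p) ^+ 2 by rewrite ler_sqr ?nnegrE// mulr_ge0.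
rewrite !exprMn.
have q2 : (1 - c ^+ 2) * p ^+ 2 <= q ^+ 2 by rewrite exprMn in s2; lra.
apply: (@le_trans _ _ ((1 + c) ^+ 2 * ((1 - c ^+ 2) * p ^+ 2))); last first.
  by rewrite ler_wpM2l// sqr_ge0.
rewrite [leRHS]mulrA ler_wpM2r ?sqr_ge0//.
(* The difference is [(1 - c) ((1 + c)^3 - (1 - c))]. *)
rewrite -subr_ge0.
have -> : (1 + c) ^+ 2 * (1 - c ^+ 2) - (1 - c) ^+ 2
  = (1 - c) * (c * (4 + 3 * c + c ^+ 2)) by ring.
by rewrite mulr_ge0 ?(ltW d0)// mulr_ge0// !addr_ge0// ?mulr_ge0 ?sqr_ge0.
Qed.

Theorem proposition3p1 (R : realType) (n l k : nat) (A : 'M[R]_n)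
    (b x xk xk' : 'cV[R]_n) (Omega : 'M[R]_(l, n)) (eps : R)
    (hA : spd A)
    (hx : x = invmx A *m b)
    (hk : (1 <= k)%N)
    (hOmega : embedding eps Omega (krylov A b k.+1 + <[x]>)%VS)
    (heps : eps < (Num.sqrt (cond2 A))^-1)
    (hxk : randomized_projection Omega A b k xk)
    (hxk' : orthogonal_projection A b k xk') :
  normA A (x - xk) <=
    (1 + eps * Num.sqrt (cond2 A)) / (1 - eps * Num.sqrt (cond2 A))
    * normA A (x - xk').
Proof.
have uA := spd_unitmx hA.
have {hOmega} emb := embedding_sub (addvSl _ _) hOmega.
case: hxk => xkK rand; case: hxk' => xk'K orth.
have Ax : A *m x = b by rewrite hx mulKVmx.
set e := x - xk; set e' := x - xk'; pose d := xk' - xk.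
have dK : d \in krylov A b k by rewrite rpredB.
have dK1 := subvP (krylov_sub _ _ (leqnSn k)) _ dK.
have rE : b - A *m xk = A *m e by rewrite mulmxBr Ax.
have rK1 : A *m e \in krylov A b k.+1.
  by rewrite -rE rpredB ?krylov_generator ?krylov_mulmx.
have eE : e = e' + d by rewrite /e /e' /d subrKA.
have [eps0|eps0] := ltP eps 0.
  have d0 := embedding_lt0 emb eps0 dK1.
  have e0 : e = 0.
    by rewrite -(mulKmx uA e) (embedding_lt0 emb eps0 rK1) mulmx0.
  have -> : e' = 0 by rewrite -e0 eE d0 addr0.
  by rewrite e0 /normA mulmx0 dot0l sqrtr0 mulr0.
set c := eps * _.
have c0 : 0 <= c by rewrite mulr_ge0// sqrtr_ge0.
have c1 : c < 1.
  rewrite /c; have [->|s0] := eqVneq (Num.sqrt (cond2 A)) 0.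
    by rewrite mulr0.
  by rewrite -(mulVf s0) ltr_pM2r// lt_def s0 sqrtr_ge0.
have e'd : dot (A *m e') d = 0 by rewrite mulmxBr Ax orth.
(* Opaque, so that the expansions below stop at [e'] and [d]. *)
clearbody e e' d.
have dd : dot (A *m e) d = normA A d ^+ 2.
  by rewrite eE mulmxDr dotDl e'd add0r normA_sqr.
apply: (@quasi_optimal_bound _ c _ _ (normA A d)); rewrite ?sqrtr_ge0//.
  rewrite !normA_sqr// eE mulmxDr !dotDl !dotDr e'd.
  by rewrite (dot_mulmxC d e' hA.1) e'd addr0 add0r.
have h : normA A d ^+ 2 <= c * normA A e * normA A d.
  rewrite -dd; have := embedding_dot emb rK1 dK1.
  rewrite -{2}rE rand// subr0 => /le_trans; apply.
  by rewrite /c -!mulrA ler_wpM2l// norm2_residual_mul_le.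
have [->|nd0] := eqVneq (normA A d) 0; first by rewrite mulr_ge0 ?sqrtr_ge0.
by rewrite -(@ler_pM2r _ (normA A d)) -?expr2// lt_def nd0 sqrtr_ge0.
Qed.
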